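(* Let $A\in\mathcal{B}(\mathcal{H})$ be a positive operator with $\dim(R(A))\ge 2$. For any $T\in\mathcal{B}_{A^{1/2}}(\mathcal{H})$ and $q\in\mathcal{D}$: (a) $W_{q,A}(T)=\left\{q\langle Tx,x\rangle_A+\sqrt{1-|q|^2}\,\langle Tx,z\rangle_A:\ x,z\in\mathcal{H},\ \|x\|_A=\|z\|_A=1,\ \langle x,z\rangle_A=0\right\}$; (b) $w_{q,A}(T)=\sup\left\{|q|\,|\langle Tx,x\rangle_A|+\sqrt{1-|q|^2}\,|\langle Tx,z\rangle_A|:\ x,z\in\mathcal{H},\ \|x\|_A=\|z\|_A=1,\ \langle x,z\rangle_A=0\right\}$.
   Context: $\mathcal{H}$ is a separable infinite-dimensional complex Hilbert space with inner product $\langle\cdot,\cdot\rangle$ (linear in the first variable); $\mathcal{B}(\mathcal{H})$ is the algebra of bounded linear operators on $\mathcal{H}$; $R(A)$ is the range of $A$. $A$ positive means $\langle Ax,x\rangle\ge 0$ for all $x$. Put $\langle x,y\rangle_A=\langle Ax,y\rangle$ and $\|x\|_A=\sqrt{\langle x,x\rangle_A}$. $\mathcal{D}=\{z\in\mathbb{C}:|z|\le 1\}$. $\mathcal{B}_{A^{1/2}}(\mathcal{H})=\{T\in\mathcal{B}(\mathcal{H}):\exists c>0,\ \|Tx\|_A\le c\|x\|_A\ \forall x\in\mathcal{H}\}$. The $A$-$q$-numerical range is $W_{q,A}(T)=\{\langle Tx,y\rangle_A: x,y\in\mathcal{H},\ \|x\|_A=\|y\|_A=1,\ \langle x,y\rangle_A=q\}$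 and the $A$-$q$-numerical radius is $w_{q,A}(T)=\sup\{|\lambda|:\lambda\in W_{q,A}(T)\}$. *)

(* Defs.v *)
From HB Require Import structures.
From mathcomp Require Import all_boot all_order all_algebra.
From mathcomp Require Import complex.
From mathcomp Require Import all_classical all_reals all_analysis.
Import Order.TTheory GRing.Theory Num.Theory.
Import numFieldNormedType.Exports.
Import Normc.

Set Implicit Arguments.
Unset Strict Implicit.
Unset Printing Implicit Defensive.

Local Open Scope classical_set_scope.
Local Open Scope ring_scope.
Local Open Scope complex_scope.

Section Hilbert.
Variables (R : realType) (H : completeNormedModType R[i]).

(* [{dot H for Num.conj}] is linear in its first argument, conjugate-linear in its
   second, Hermitian and positive definite. With this condition, the complete
   normed space H is a Hilbert space for the inner product [ip]. *)
Definition norm_from_dot (ip : {dot H for Num.conj}) : Prop :=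
  forall x : H, `|x| ^+ 2 = ip x x.

Definition separable_space : Prop := exists2 D : set H, countable D & dense D.

Definition lin_indep (n : nat) (v : 'I_n -> H) : Prop :=
  forall c : 'I_n -> R[i], \sum_(i < n) c i *: v i = 0 -> forall i, c i = 0.

(* dim V >= n, for V a subspace of H of finite or infinite dimension *)
Definition dim_ge (n : nat) (V : set H) : Prop :=
  exists2 v : 'I_n -> H, (forall i, V (v i)) & lin_indep v.

Definition infinite_dimensional : Prop := forall n, dim_ge n [set: H].

Definition bounded_operator (T : {linear H -> H}) : Prop :=
  exists M : R, forall x : H, `|T x| <= M%:C * `|x|.

Variable ip : {dot H for Num.conj}.

(* The order of R[i] makes [0 <= z] say that z is real and nonnegative. *)
Definition positive_operator (A : {linear H -> H}) : Prop :=
  forall x : H, 0 <= ip (A x) x.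

Variable A : {linear H -> H}.

Definition A_ip (x y : H) : R[i] := ip (A x) y.

(* [A_ip x x] is real and nonnegative when A is positive. *)
Definition A_norm (x : H) : R := Num.sqrt (complex.Re (A_ip x x)).

Definition A_bounded_operator (T : {linear H -> H}) : Prop :=
  bounded_operator T /\
  exists2 c : R, 0 < c & forall x : H, A_norm (T x) <= c * A_norm x.

Definition A_q_numerical_range (q : R[i]) (T : {linear H -> H}) : set R[i] :=
  [set l | exists x y : H, [/\ A_norm x = 1, A_norm y = 1, A_ip x y = q &
                            l = A_ip (T x) y]].

Definition A_q_numerical_radius (q : R[i]) (T : {linear H -> H}) : \bar R :=
  ereal_sup [set (normc l)%:E | l in A_q_numerical_range q T].

End Hilbert.

Arguments separable_space {R} H.
Arguments infinite_dimensional {R} H.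

(* Main.v *)
Require Import Defs.
From HB Require Import structures.
From mathcomp Require Import all_boot all_order all_algebra.
From mathcomp Require Import complex.
From mathcomp Require Import ring.
From mathcomp Require Import all_classical all_reals all_analysis.
Import numFieldNormedType.Exports.
Import Normc.
Import Order.TTheory GRing.Theory Num.Theory.

Local Open Scope classical_set_scope.
Local Open Scope ring_scope.
Local Open Scope complex_scope.

(** Positivity of A makes the form <x, y>_A Hermitian and positive semidefinite
    ([A_ipC], [A_ip_ge0]), and its isotropic vectors are exactly the kernel of A
    ([A_ip_eq0]).  Hence the usual geometry of unit vectors survives.

    Fix an A-unit vector x.  For an A-unit vector y with <x, y>_A = q, the
    component w = y - conj(q) x of y is A-orthogonal to x, and its squared A-norm
    is 1 - |q|^2.  If |q| < 1, rescaling w gives an A-unit vector z with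
    y = conj(q) x + sqrt(1 - |q|^2) z; conversely such a combination of
    A-orthonormal vectors is an A-unit vector with <x, y>_A = q.  Expanding
    <Tx, y>_A gives (a).  If |q| = 1, then w is isotropic, so it contributes
    nothing to <Tx, y>_A and the coefficient of <Tx, z>_A vanishes; it only
    remains to find some z A-orthonormal to x.  The hypothesis on the rank
    gives one: otherwise A would send every u to a multiple of Ax, and
    the range of A would be at most a line ([exists_A_orthonormal]).

    For (b), one inequality is the triangle inequality.  The other holds because
    z may be multiplied by a unit scalar without disturbing the constraints, and
    a suitable scalar brings the two summands in (a) to the same argument
    ([phase_align]). *)

(** * Complex scalars *)

Section ComplexScalars.
Set Implicit Arguments.
Unset Strict Implicit.
Variable R : realType.
Implicit Types a b q : R[i].

Lemma polar a : exists2 u, `|u| = 1 & a = `|a| * u.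
Proof.
have [->|a0] := eqVneq a 0; first by exists 1; rewrite ?normr1 // normr0 mul0r.
exists (a / `|a|); first by rewrite normf_div normr_id divff ?normr_eq0.
by rewrite mulrC divfK ?normr_eq0.
Qed.

(** The unit scalar is the quotient of the phases of [a] and [b]. *)
Lemma phase_align a b :
  exists2 u, u * Num.conj u = 1 & normc (a + u * b) = normc a + normc b.
Proof.
have [ua ua1 ea] := polar a; have [ub ub1 eb] := polar b.
have ub0 : ub != 0 by rewrite -normr_eq0 ub1 oner_eq0.
exists (ua / ub); first by rewrite -normCK normf_div ua1 ub1 divr1 expr1n.
apply: complexI; rewrite rmorphD -[LHS]/`|a + ua / ub * b| -[RHS]/(`|a| + `|b|).
rewrite {1}ea {1}eb [`|b| * ub]mulrC mulrA divfK // mulrC -mulrDr normrM ua1 mul1r.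
by rewrite ger0_norm // addr_ge0.
Qed.

Lemma conj_real (t : R) : Num.conj t%:C = t%:C.
Proof. exact: conjc_real. Qed.

Lemma sqrt_one_sub_normsq q : normc q <= 1 ->
  (Num.sqrt (1 - normc q ^+ 2))%:C ^+ 2 = 1 - q * Num.conj q.
Proof.
move=> q1; have q0 : 0 <= normc q by case: (q) => *; exact: sqrtr_ge0.
rewrite -rmorphXn sqr_sqrtr; last by rewrite subr_ge0 expr_le1.
by rewrite rmorphB rmorphXn rmorph1 -normCK.
Qed.

End ComplexScalars.

(** * The semi-inner product of a positive operator *)

Section SemiInnerProduct.
Set Implicit Arguments.
Unset Strict Implicit.
Variables (R : realType) (H : completeNormedModType R[i]).
Variables (ip : {dot H for Num.conj}) (A : {linear H -> H}).
Hypothesis A_positive : positive_operator ip A.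
Implicit Types (x y z w : H) (a q : R[i]).
Local Notation "<[ x , y ]>" := (A_ip ip A x y).

Lemma A_ipDl x y z : <[x + y, z]> = <[x, z]> + <[y, z]>.
Proof. by rewrite /A_ip linearD linearDl. Qed.

Lemma A_ipZl a x y : <[a *: x, y]> = a * <[x, y]>.
Proof. by rewrite /A_ip linearZ linearZl_LR. Qed.

Lemma A_ipDr x y z : <[x, y + z]> = <[x, y]> + <[x, z]>.
Proof. by rewrite /A_ip linearDr. Qed.

Lemma A_ipZr a x y : <[x, a *: y]> = Num.conj a * <[x, y]>.
Proof. by rewrite /A_ip linearZr_LR. Qed.

Lemma A_ip_sqD a x y : <[x + a *: y, x + a *: y]> =
  <[x, x]> + (Num.conj a * <[x, y]> + a * <[y, x]>) + a * Num.conj a * <[y, y]>.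
Proof. by rewrite A_ipDl !A_ipDr !A_ipZl !A_ipZr mulrA !addrA. Qed.

Lemma A_ip_ge0 x : 0 <= <[x, x]>. Proof. exact: A_positive. Qed.

Lemma A_ip_real x : <[x, x]> \is Num.real.
Proof. exact/ger0_real/A_ip_ge0. Qed.

(** Polarization: the cross terms of the real number <x + a y, x + a y>_A are
    real for every [a]; the values 1 and i of [a] compare the imaginary and the
    real parts of <x, y>_A and <y, x>_A. *)
Lemma A_ipC x y : <[x, y]> = Num.conj <[y, x]>.
Proof.
have real_cross a : Num.conj a * <[x, y]> + a * <[y, x]> \is Num.real.
  have -> : Num.conj a * <[x, y]> + a * <[y, x]> =
      <[x + a *: y, x + a *: y]> - <[x, x]> - a * Num.conj a * <[y, y]>.
    by rewrite A_ip_sqD; ring.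
  by rewrite !rpredB ?A_ip_real // -normCK rpredM ?A_ip_real // rpredX // normr_real.
move: (real_cross 1) (real_cross 'i%R).
rewrite rmorph1 !mul1r conjCi => /CrealP + /CrealP.
rewrite !rmorphD !rmorphM rmorphN /= conjCi opprK.
set b := <[y, x]>; set c := <[x, y]>; set b' := Num.conj b; set c' := Num.conj c.
move=> e1 e2; have {}e2 : c' - b' = b - c.
  apply: (mulfI (neq0Ci _)); move: e2; set i := 'i%R => e2.
  transitivity (i * c' + - i * b'); first by ring.
  by rewrite e2; ring.
have : 2 * b' = 2 * c.
  transitivity ((c' + b') - (c' - b')); first by ring.
  by rewrite e1 e2; ring.
by move/(mulfI _) => ->; rewrite ?pnatr_eq0.
Qed.

(** If <x, x>_A = 0, moving from [x] a short way along [- A x] changes <., .>_A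
    by [- 2 t ip (A x) (A x)] to first order in [t], while the result stays
    nonnegative. *)
Lemma A_ip_eq0 x : <[x, x]> = 0 -> A x = 0.
Proof.
have [//|] := eqVneq (A x) 0; rewrite -(dnorm_gt0 ip).
set N := ip _ _ => Ngt0 x0; set M := <[A x, A x]>.
have M1gt0 : 0 < 1 + M by rewrite ltr_wpDr ?A_ip_ge0.
(* The quadratic - 2 t N + t^2 M is negative for 0 < t M < 2 N; adding 1 to the
   denominator covers M = 0. *)
set t := N / (1 + M).
have tgt0 : 0 < t by rewrite divr_gt0.
have tC : Num.conj t = t by apply/CrealP/ger0_real/ltW.
have NC : Num.conj N = N by apply/CrealP/ger0_real/ltW.
have := A_ip_ge0 (x + - t *: A x).
rewrite A_ip_sqD x0 [<[A x, x]>]A_ipC -/M.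
have -> : <[x, A x]> = N by [].
rewrite rmorphN /= tC NC add0r.
have -> : - t * N + - t * N + - t * - t * M = t * (t * M - 2 * N) by ring.
rewrite pmulr_rge0 // subr_ge0 => /le_lt_trans absurd_le.
have /absurd_le : t * M < 2 * N; last by rewrite ltxx.
rewrite /t mulrAC ltr_pdivrMr // -subr_gt0.
have -> : 2 * N * (1 + M) - N * M = 2 * N + N * M by ring.
by rewrite ltr_wpDr ?mulr_ge0 ?mulr_gt0 ?A_ip_ge0 // ltW.
Qed.

Lemma A_norm_eq1 x : A_norm ip A x = 1 <-> <[x, x]> = 1.
Proof.
rewrite /A_norm; split=> [e|->]; last by rewrite sqrtr1.
have := A_ip_ge0 x; have /RRe_real := A_ip_real x.
set t := complex.Re _ in e *; move=> <-; rewrite ler0c => t0.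
by rewrite -(sqr_sqrtr t0) e expr1n.
Qed.

Lemma A_normalize w : <[w, w]> != 0 ->
  exists k, <[k *: w, k *: w]> = 1.
Proof.
have /RRe_real := A_ip_real w; set t := complex.Re _ => et w0.
have t0 : 0 < t by rewrite -ltcR et lt_def w0 A_ip_ge0.
exists (Num.sqrt t)^-1%:C.
rewrite A_ipZl A_ipZr conj_real -et -!rmorphM /= mulrA -invfM -expr2 sqr_sqrtr ?ltW //.
by rewrite mulVf ?gt_eqF.
Qed.

Lemma line_dim_lt2 (V : set H) x :
  (forall v, V v -> exists a, v = a *: x) -> ~ dim_ge 2 V.
Proof.
move=> V_line [v vV v_indep].
have [a va] := V_line _ (vV ord0); have [b vb] := V_line _ (vV ord_max).
have v_rel c d : c *: v ord0 + d *: v ord_max = 0 -> c = 0 /\ d = 0.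
  move=> cd; have := v_indep (fun i => if i == ord0 then c else d).
  rewrite big_ord_recl big_ord1 /= (_ : lift _ _ = ord_max); last exact/val_inj.
  by rewrite cd => /(_ erefl) h; split; [exact: (h ord0)|exact: (h ord_max)].
have [_ /eqP] : b = 0 /\ - a = 0.
  by apply: v_rel; rewrite va vb !scalerA mulNr mulrC scaleNr subrr.
rewrite oppr_eq0 => /eqP a0.
have [/eqP] : (1 : R[i]) = 0 /\ (0 : R[i]) = 0.
  by apply: v_rel; rewrite va a0 !scale0r scaler0 addr0.
by rewrite oner_eq0.
Qed.

(** Gram-Schmidt against [x] yields a vector that can be normalized unless
    every [u - <u, x>_A x] lies in the kernel of [A], that is, unless
    [A u = <u, x>_A A x] for every [u]. *)
Lemma exists_A_orthonormal x : dim_ge 2 (range A) -> <[x, x]> = 1 ->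
  exists2 z, <[z, z]> = 1 & <[x, z]> = 0.
Proof.
move=> A_rank x1; pose p u := u + - <[u, x]> *: x.
have [[u pu]|p_null] := pselect (exists u, <[p u, p u]> != 0).
  have [k k1] := A_normalize pu; exists (k *: p u) => //.
  by rewrite A_ipZr A_ipDr A_ipZr x1 mulr1 rmorphN /= -A_ipC subrr mulr0.
suff /line_dim_lt2 : forall v, range A v -> exists a, v = a *: A x by [].
move=> _ [u _ <-]; exists <[u, x]>; apply: subr0_eq.
rewrite -scaleNr -linearZ -linearD; apply: A_ip_eq0.
by apply/eqP; apply: contrapT => /negP pu; apply: p_null; exists u.
Qed.

(** * The A-q-numerical range and radius *)

Lemma A_ip_sq_defect q x y : <[x, x]> = 1 -> <[y, y]> = 1 -> <[x, y]> = q ->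
  let w := y + - Num.conj q *: x in
  <[w, w]> = 1 - q * Num.conj q /\ <[x, w]> = 0.
Proof.
move=> x1 y1 xy; split; last first.
  by rewrite A_ipDr A_ipZr x1 xy rmorphN /= conjCK mulr1 subrr.
by rewrite A_ip_sqD x1 y1 xy [<[y, x]>]A_ipC xy rmorphN /= conjCK; ring.
Qed.

Lemma A_ip_isotropic_r x y : <[y, y]> = 0 -> <[x, y]> = 0.
Proof. by move=> /A_ip_eq0 y0; rewrite A_ipC /A_ip y0 linear0l rmorph0. Qed.

(** When |q| = 1 the component [w] of [y] cannot be rescaled, but it is isotropic
    and any [z] A-orthonormal to [x] serves. *)
Lemma A_ip_unit_decomposition (T : H -> H) q x y :
  dim_ge 2 (range A) -> normc q <= 1 ->
  <[x, x]> = 1 -> <[y, y]> = 1 -> <[x, y]> = q ->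
  exists z, [/\ <[z, z]> = 1, <[x, z]> = 0 &
   <[T x, y]> = q * <[T x, x]> + (Num.sqrt (1 - normc q ^+ 2))%:C * <[T x, z]>].
Proof.
move=> A_rank /sqrt_one_sub_normsq; set s := _%:C => s2 x1 y1 xy.
have [] := A_ip_sq_defect x1 y1 xy; set w := y + _; rewrite -s2 => ww xw.
have Tw : <[T x, y]> = q * <[T x, x]> + <[T x, w]>.
  by rewrite A_ipDr A_ipZr rmorphN /= conjCK; ring.
have [s0|s0] := eqVneq s 0.
  have [z z1 xz] := exists_A_orthonormal A_rank x1.
  exists z; split=> //; rewrite Tw s0 mul0r (@A_ip_isotropic_r _ w) //.
  by rewrite ww s0 expr0n.
exists (s^-1 *: w); split.
- by rewrite A_ipZl A_ipZr ww /s -fmorphV conj_real fmorphV -/s; field.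
- by rewrite A_ipZr xw mulr0.
by rewrite Tw A_ipZr /s -fmorphV conj_real fmorphV -/s mulVKf.
Qed.

Lemma A_ip_unit_combination (T : H -> H) q x z :
  normc q <= 1 -> <[x, x]> = 1 -> <[z, z]> = 1 -> <[x, z]> = 0 ->
  exists y, [/\ <[y, y]> = 1, <[x, y]> = q &
   <[T x, y]> = q * <[T x, x]> + (Num.sqrt (1 - normc q ^+ 2))%:C * <[T x, z]>].
Proof.
move=> /sqrt_one_sub_normsq; set s := _%:C => s2 x1 z1 xz.
have sC : Num.conj s = s by exact: conj_real.
exists (Num.conj q *: x + s *: z); split.
- rewrite A_ip_sqD A_ipZl !A_ipZr A_ipZl x1 z1 xz [<[z, x]>]A_ipC xz rmorph0 conjCK sC.
  by rewrite !mulr0 !addr0 !mulr1 -expr2 s2; ring.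
- by rewrite A_ipDr !A_ipZr x1 xz conjCK mulr1 mulr0 addr0.
by rewrite A_ipDr !A_ipZr conjCK sC.
Qed.

Lemma A_q_numerical_rangeE (T : {linear H -> H}) q :
  dim_ge 2 (range A) -> normc q <= 1 ->
  A_q_numerical_range ip A q T =
    [set l | exists x z : H,
      [/\ A_norm ip A x = 1, A_norm ip A z = 1, <[x, z]> = 0 &
          l = q * <[T x, x]> + (Num.sqrt (1 - normc q ^+ 2))%:C * <[T x, z]>]].
Proof.
move=> A_rank q1.
apply/seteqP; split=> l [x [y [/A_norm_eq1 x1 /A_norm_eq1 y1 xy ->]]].
  have [z [/A_norm_eq1 z1 xz ->]] :=
    A_ip_unit_decomposition T A_rank q1 x1 y1 xy.
  by exists x, z; split=> //; apply/A_norm_eq1.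
have [z [/A_norm_eq1 z1 xz <-]] := A_ip_unit_combination T q1 x1 y1 xy.
by exists x, z; split=> //; apply/A_norm_eq1.
Qed.

End SemiInnerProduct.

Theorem proposition2p2 (R : realType) (H : completeNormedModType R[i])
    (ip : {dot H for Num.conj})
    (H_hilbert : norm_from_dot ip)
    (H_separable : separable_space H)
    (H_infinite : infinite_dimensional H)
    (A : {linear H -> H})
    (A_bounded : bounded_operator A)
    (A_positive : positive_operator ip A)
    (A_rank : dim_ge 2 (range A))
    (T : {linear H -> H})
    (T_bounded : A_bounded_operator ip A T)
    (q : R[i])
    (q_disc : normc q <= 1) :
  A_q_numerical_range ip A q T =
    [set l | exists x z : H,
      [/\ A_norm ip A x = 1, A_norm ip A z = 1, A_ip ip A x z = 0 &
          l = q * A_ip ip A (T x) x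
              + (Num.sqrt (1 - normc q ^+ 2))%:C * A_ip ip A (T x) z]]
  /\
  A_q_numerical_radius ip A q T =
    ereal_sup [set r | exists x z : H,
      [/\ A_norm ip A x = 1, A_norm ip A z = 1, A_ip ip A x z = 0 &
          r = (normc q * normc (A_ip ip A (T x) x)
               + Num.sqrt (1 - normc q ^+ 2)
                 * normc (A_ip ip A (T x) z))%:E]].
Proof.
have range_eq := A_q_numerical_rangeE A_positive T A_rank q_disc.
split=> //; rewrite /A_q_numerical_radius range_eq; set s := Num.sqrt _.
have s_ge0 : 0 <= s by exact: sqrtr_ge0.
have normc_s (b : R[i]) : normc (s%:C * b) = s * normc b.
  by rewrite normcM; congr (_ * _); rewrite /normc /= expr0n addr0 sqrtr_sqr ger0_norm.
apply/eqP; rewrite eq_le; apply/andP; split; apply: ge_ereal_sup.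
  move=> _ [_ [x [z [x1 z1 xz ->]]] <-].
  apply: (@le_trans _ _
    (normc q * normc (A_ip ip A (T x) x) + s * normc (A_ip ip A (T x) z))%:E).
    by rewrite lee_fin -normcM -normc_s le_normcD.
  by apply: ereal_sup_ubound; exists x, z.
move=> _ [x [z [x1 /(A_norm_eq1 A_positive) z1 xz ->]]].
have [u u1 align] := phase_align (q * A_ip ip A (T x) x) (s%:C * A_ip ip A (T x) z).
(* The form is conjugate-linear in its second argument, so the factor u appears
   on <Tx, z>_A when z is multiplied by its conjugate. *)
apply: ereal_sup_ubound.
exists (q * A_ip ip A (T x) x + s%:C * A_ip ip A (T x) (Num.conj u *: z)).
  exists x, (Num.conj u *: z); split=> //.
    by apply/(A_norm_eq1 A_positive); rewrite A_ipZl A_ipZr conjCK z1 mulr1 mulrC u1.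
  by rewrite A_ipZr xz mulr0.
by rewrite A_ipZr conjCK mulrCA align (normcM q) normc_s.
Qed.
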